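(* Let $(p,\mathbf n)$ be a principal contact element net that admits a Bäcklund transform $(q,\mathbf m)$, with all genericity assumptions listed in the context in force. Let $d$ be the (constant) distance between corresponding points $p_i,q_i$ and $\varphi$ the (constant) angle between corresponding normals $\mathbf n_i,\mathbf m_i$. Then $(p,\mathbf n)$ is of constant negative Gaussian curvature $$K=-\frac{\sin^2\varphi}{d^2},$$ i.e. every elementary quadrilateral of $(p,\mathbf n)$ has Gaussian curvature $K=-\sin^2\varphi/d^2$.
   Context: A contact element is a pair $(p,\mathbf n)$ of a point $p$ in Euclidean three-space $E^3$ and a unit vector $\mathbf n\in\mathbb R^3$. Its normal line $N$ is the oriented line through $p$ with direction $\mathbf n$; its tangent plane $\pi$ is the plane through $p$ with oriented normal $\mathbf n$. A contact element net is a map $(p,\mathbf n)$ from $\mathbb Z^k$, $k\ge 2$, to the set of contact elements; the value at $i\in\mathbb Z^k$ is $(p_i,\mathbf n_i)$. It is a principal contact element net if any two neighbouring contact elements $(p_i,\mathbf n_i)$, $(p_j,\mathbf n_j)$ have a common oriented tangent sphere, i.e. there is $r\in\mathbb R$ with $p_i+r\mathbf n_i=p_j+r\mathbf n_j$. An elementary quadrilateral consists of the four contact elements, in cyclic order, on a unit 2-face of $\mathbb Z^k$. For such a quadrilateral $(p_0,\mathbf n_0),\dots,(p_3,\mathbf n_3)$ the points $p_i$ lie on a circle, and corresponding edges of the polygons $p_0p_1p_2p_3$ and $\mathbf n_0\mathbf n_1\mathbf n_2\mathbf n_3$ are parallel, so these polygons lie in parallel planes. Gaussian curvature of an elementary quadrilateral: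 $K=S_0/S$, where $S_0$ is the oriented area of the (planar) quadrilateral with vertices $\mathbf n_0,\mathbf n_1,\mathbf n_2,\mathbf n_3$ on the unit sphere and $S$ is the oriented area of the quadrilateral $p_0,p_1,p_2,p_3$ (both with respect to the same unit normal of the parallel planes). Two principal contact element nets $(p,\mathbf n)$, $(q,\mathbf m)$ (over the same $\mathbb Z^k$) with tangent planes $\pi_i,\chi_i$ are Bäcklund mates, and each is called a Bäcklund transform of the other, if: (1) the distance of corresponding points $p_i,q_i$ is constant; (2) the angle of corresponding normals $\mathbf n_i,\mathbf m_i$ is constant, measured consistently counter-clockwise when viewed along the ray from $p_i$ to $q_i$; (3) corresponding tangent planes $\pi_i$ and $\chi_i$ intersect in the connecting line $p_i\vee q_i$. Standing genericity assumptions: the Gaussian curvature of every elementary quadrilateral is well defined ($S\neq0$). For each pair of corresponding elementary quadrilaterals, let $A_0,\dots,A_3$ be the direct Euclidean displacements (from a moving space to the fixed space) carrying one fixed congruent model figure onto the figures $\{(p_i,\mathbf n_i),(q_i,\mathbf m_i)\}$; consecutive $A_i,A_{i+1}$ (indices mod 4) differ by a rotation whose axis, pulled back to the moving space, is $K_{i,i+1}=\{x: A_i(x)=A_{i+1}(x)\}$. It is assumed that the four lines $K_{01},K_{12},K_{23},K_{30}$ have exactly two common transversals and that neighbouring ones are skew. *)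

(* Defs.v *)
From HB Require Import structures.
From mathcomp Require Import all_boot all_order all_algebra.
From mathcomp Require Import all_classical all_reals all_analysis.
Set Implicit Arguments.
Unset Strict Implicit.
Unset Printing Implicit Defensive.
Import Order.TTheory GRing.Theory Num.Theory.
Local Open Scope classical_set_scope.
Local Open Scope ring_scope.

Section Euclidean.
Variable R : realType.
Implicit Types u v x y z a b : 'rV[R]_3.

Definition dot u v : R := \sum_(l < 3) u 0 l * v 0 l.

(* The norm `|_| of MathComp-Analysis on matrices is the sup norm. *)
Definition enorm u : R := Num.sqrt (dot u u).

(* Indices are taken in 'I_3 as the ring of integers mod 3. *)
Definition cross u v : 'rV[R]_3 :=
  \row_(l < 3) (u 0 (l + 1) * v 0 (l + 2) - u 0 (l + 2) * v 0 (l + 1)).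

Definition line_through a u : set 'rV[R]_3 :=
  [set x | exists t : R, x = a + t *: u].

Definition plane_through a u : set 'rV[R]_3 :=
  [set x | dot (x - a) u = 0].

Definition is_line (L : set 'rV[R]_3) : Prop :=
  exists a u, u != 0 /\ L = line_through a u.

Definition is_plane (H : set 'rV[R]_3) : Prop :=
  exists a u, u != 0 /\ H = plane_through a u.

Definition skew (L L' : set 'rV[R]_3) : Prop :=
  [/\ is_line L, is_line L' &
      ~ (exists H, [/\ is_plane H, L `<=` H & L' `<=` H])].

Definition common_transversal (K : 'I_4 -> set 'rV[R]_3)
    (L : set 'rV[R]_3) : Prop :=
  is_line L /\ forall j, K j `&` L !=set0.

(* Signed area, with respect to the unit normal w, of a closed quadrilateral
   whose vertices lie in a plane orthogonal to w (shoelace formula; indices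
   are mod 4, and the value does not depend on the origin). *)
Definition oriented_area w (x : 'I_4 -> 'rV[R]_3) : R :=
  2^-1 * \sum_(j < 4) dot (cross (x j) (x (j + 1))) w.

(* Oriented angle between the vectors n and m (orthogonal to the unit vector u,
   both of unit length), counter-clockwise for an observer who looks in
   direction u.  Such an observer sees right-handed rotations about u as
   clockwise, hence m `x` n rather than n `x` m in the sine. *)
Definition is_ccw_angle (u n m : 'rV[R]_3) (phi : R) : Prop :=
  dot n m = cos phi /\ dot (cross m n) u = sin phi.

Record contact_element := ContactElement {
  pt : 'rV[R]_3;
  nrm : 'rV[R]_3;
  nrm_unit : enorm nrm = 1 }.

Definition tangent_plane (c : contact_element) : set 'rV[R]_3 :=
  plane_through (pt c) (nrm c).

Definition common_tangent_sphere (c c' : contact_element) : Prop :=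
  exists r : R, pt c + r *: nrm c = pt c' + r *: nrm c'.

(* Direct Euclidean displacements, acting on row vectors from the right. *)
Record displacement := Displacement {
  rotation_part : 'M[R]_3;
  translation_part : 'rV[R]_3;
  rotation_part_orth : rotation_part *m rotation_part^T = 1%:M;
  rotation_part_det : \det rotation_part = 1 }.

Definition move (A : displacement) x : 'rV[R]_3 :=
  x *m rotation_part A + translation_part A.

Definition carries (A : displacement) (c c' : contact_element) : Prop :=
  move A (pt c) = pt c' /\ nrm c *m rotation_part A = nrm c'.

Definition relative_axis (A B : displacement) : set 'rV[R]_3 :=
  [set x | move A x = move B x].

Definition gaussian_curvature (c : 'I_4 -> contact_element) (K : R) : Prop :=
  exists w, [/\ enorm w = 1,
    forall j, dot (pt (c (j + 1)) - pt (c j)) w = 0,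
    forall j, dot (nrm (c (j + 1)) - nrm (c j)) w = 0,
    oriented_area w (pt \o c) != 0 &
    K = oriented_area w (nrm \o c) / oriented_area w (pt \o c)].

(* (M, M') is the model figure in the moving space. *)
Definition generic_pair (c c' : 'I_4 -> contact_element) : Prop :=
  exists (M M' : contact_element) (A : 'I_4 -> displacement),
    let K j := relative_axis (A j) (A (j + 1)) in
    [/\ forall j, carries (A j) M (c j) /\ carries (A j) M' (c' j),
        forall j, is_line (K j),
        forall j, skew (K j) (K (j + 1)) &
        exists L L', [/\ common_transversal K L, common_transversal K L',
          L <> L' &
          forall T, common_transversal K T -> T = L \/ T = L']].

End Euclidean.

Section Nets.
Variables (R : realType) (k : nat).

Definition net := 'rV[int]_k -> contact_element R.

Definition unit_step (a : 'I_k) : 'rV[int]_k := delta_mx 0 a.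

Definition principal (f : net) : Prop :=
  forall i a, common_tangent_sphere (f i) (f (i + unit_step a)).

(* The vertices of the unit 2-face at i in directions a and b, in cyclic
   order; it is only used for a != b. *)
Definition quad (f : net) (i : 'rV[int]_k) (a b : 'I_k) (j : 'I_4) :
    contact_element R :=
  tnth [tuple f i; f (i + unit_step a); f (i + unit_step a + unit_step b);
              f (i + unit_step b)] j.

Definition backlund_mates (f g : net) (d phi : R) : Prop :=
  [/\ principal f, principal g &
   forall i, let p := pt (f i) in let q := pt (g i) in
     [/\ enorm (q - p) = d,
         is_ccw_angle (d^-1 *: (q - p)) (nrm (f i)) (nrm (g i)) phi,
         p <> q &
         tangent_plane (f i) `&` tangent_plane (g i)
           = line_through p (q - p)]].

End Nets.

(* Main.v *)
(** At the edge from [j] to [j + 1] let [r_j], [s_j] be the signed radii of the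
    common tangent spheres of the two nets.  In the moving space the centres
    [P + r_j N] and [Q + s_j M] lie on the axis [K_j]; skewness of neighbouring
    axes makes consecutive radii distinct, which forces the normals [m_j] of the
    second net, like the [n_j], to be coplanar points of the sphere.
    The reflection exchanging [m_j] and [m_(j+1)] fixes both the direction
    [(q_j + s_j m_j) - (p_j + r_j n_j)] of the displaced axis and the normal of
    the plane of the [m_j].  Hence the oriented angles between the tangential
    parts of these two vectors at [m_j] and at [m_(j+1)] are opposite.  Going
    once around the quadrilateral shows that
      [(d + i r_0 sin phi) (d - i r_1 sin phi)
       (d + i r_2 sin phi) (d - i r_3 sin phi)]
    is real.  The ratio [S_0 / S] is a function of [r_0, ..., r_3] only, and this
    relation says precisely that it equals [- sin^2 phi / d^2]. *)
Require Import Defs.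
From mathcomp Require Import all_boot all_order all_algebra.
From mathcomp Require Import all_classical all_reals all_analysis.
From mathcomp Require Import ring lra.
Import Order.TTheory GRing.Theory Num.Theory.
Set Implicit Arguments.
Unset Strict Implicit.
Unset Printing Implicit Defensive.
Local Open Scope ring_scope.

(** * Dot and cross products, and orthonormal frames, in three-space *)

Section VectorAlgebra.
Variable R : realType.
Implicit Types (u v w b : 'rV[R]_3) (t : R).

Lemma dotE u v :
  dot u v = u 0 0 * v 0 0 + u 0 1 * v 0 1 + u 0 2%:R * v 0 2%:R.
Proof.
rewrite /dot !big_ord_recl big_ord0 addr0 addrA.
by congr (_ * _ + _ * _ + _ * _); congr (_ _ _); apply: val_inj.
Qed.

Lemma crossE u v :
  (cross u v 0 0 = u 0 1 * v 0 2%:R - u 0 2%:R * v 0 1) *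
  (cross u v 0 1 = u 0 2%:R * v 0 0 - u 0 0 * v 0 2%:R) *
  (cross u v 0 2%:R = u 0 0 * v 0 1 - u 0 1 * v 0 0).
Proof.
by split; [split|]; rewrite mxE; congr (_ * _ - _ * _); congr (_ _ _);
  apply: val_inj.
Qed.

Lemma rV3P u v :
  u 0 0 = v 0 0 -> u 0 1 = v 0 1 -> u 0 2%:R = v 0 2%:R -> u = v.
Proof.
move=> h0 h1 h2; apply/rowP => -[[|[|[|//]]] hi].
- by rewrite (_ : Ordinal hi = 0) //; apply: val_inj.
- by rewrite (_ : Ordinal hi = 1) //; apply: val_inj.
- by rewrite (_ : Ordinal hi = 2%:R) //; apply: val_inj.
Qed.

Lemma dotC u v : dot u v = dot v u.
Proof. by rewrite !dotE; ring. Qed.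

Lemma dotDl u v w : dot (u + v) w = dot u w + dot v w.
Proof. by rewrite !dotE !mxE; ring. Qed.

Lemma dotBl u v w : dot (u - v) w = dot u w - dot v w.
Proof. by rewrite !dotE !mxE; ring. Qed.

Lemma dotZl t u w : dot (t *: u) w = t * dot u w.
Proof. by rewrite !dotE !mxE; ring. Qed.

Lemma dot0l w : dot 0 w = 0.
Proof. by rewrite !dotE !mxE; ring. Qed.

Lemma dotBr u v w : dot w (u - v) = dot w u - dot w v.
Proof. by rewrite !(dotC w) dotBl. Qed.

Lemma dotZr t u w : dot w (t *: u) = t * dot w u.
Proof. by rewrite !(dotC w) dotZl. Qed.

Lemma dot_ge0 u : 0 <= dot u u.
Proof. by rewrite dotE -!expr2 !addr_ge0 ?sqr_ge0. Qed.

Lemma dot_eq0 u : (dot u u == 0) = (u == 0).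
Proof.
apply/eqP/eqP => [|->]; last exact: dot0l.
rewrite dotE => h.
have sq x : 0 <= x * x :> R by rewrite -expr2 sqr_ge0.
by apply: rV3P; rewrite mxE; apply/eqP; rewrite -sqrf_eq0 expr2; apply/eqP;
  have := sq (u 0 0); have := sq (u 0 1); have := sq (u 0 2%:R); lra.
Qed.

Lemma enorm_sqr u : enorm u ^+ 2 = dot u u.
Proof. by rewrite sqr_sqrtr ?dot_ge0. Qed.

Lemma nrm_dot (c : contact_element R) : dot (nrm c) (nrm c) = 1.
Proof. by rewrite -enorm_sqr nrm_unit expr1n. Qed.

Lemma cross_dotA u v w : dot (cross u v) w = dot (cross v w) u.
Proof. by rewrite !dotE ?crossE; ring. Qed.

Lemma cross_cross u v w :
  cross u (cross v w) = dot u w *: v - dot u v *: w.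
Proof. by apply: rV3P; rewrite ?(crossE, dotE, mxE); ring. Qed.

Lemma dot_cross_cross u v w b :
  dot (cross u v) (cross w b) = dot u w * dot v b - dot u b * dot v w.
Proof. by rewrite !dotE ?crossE; ring. Qed.

Lemma triple_ortho b u v w :
  b != 0 -> dot u b = 0 -> dot v b = 0 -> dot w b = 0 ->
  dot (cross u v) w = 0.
Proof.
move=> b0 ub vb wb; apply/eqP; move: b0; apply: contraNT => det0.
suff : dot (cross u v) w *: b = 0 by move/eqP; rewrite scaler_eq0 (negPf det0).
(* Cramer's rule: [b] times the determinant of [u], [v], [w]. *)
transitivity (dot u b *: cross v w + dot v b *: cross w u
              + dot w b *: cross u v).
  by apply: rV3P; rewrite ?(crossE, dotE, mxE); ring.
by rewrite ub vb wb !scale0r !addr0.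
Qed.

Lemma exists_ortho u v : exists2 w, w != 0 & dot u w = 0 /\ dot v w = 0.
Proof.
pose B := col_mx u v.
have : kermx B^T != 0.
  (* [B^T] has three rows but rank at most two. *)
  rewrite kermx_eq0 /row_free mxrank_tr neq_ltn.
  by rewrite (leq_ltn_trans (rank_leq_row B)).
case/rowV0Pn=> w /sub_kermxP wB w0; exists w => //.
have wk (k : 'I_(1 + 1)) : \sum_j w 0 j * B k j = 0.
  transitivity ((w *m B^T) 0 k); last by rewrite wB mxE.
  by rewrite mxE; apply: eq_bigr => j _; rewrite [B^T _ _]mxE.
split; rewrite dotC.
- rewrite -[RHS](wk (lshift 1 0)); apply: eq_bigr => j _.
  by rewrite col_mxEu.
- rewrite -[RHS](wk (rshift 1 0)); apply: eq_bigr => j _.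
  by rewrite col_mxEd.
Qed.

Section Frame.
Variables e m : 'rV[R]_3.
Hypotheses (ee : dot e e = 1) (mm : dot m m = 1) (me : dot m e = 0).
Let t := cross m e.

Lemma frame_cross : cross e t = m.
Proof. by rewrite /t cross_cross ee dotC me scale0r subr0 scale1r. Qed.

Lemma frame_dot v w :
  dot v w = dot v e * dot w e + dot v m * dot w m + dot v t * dot w t.
Proof.
have tt : dot t t = 1 by rewrite dot_cross_cross ee mm me mul0r subr0 mulr1.
have et : dot e t = 0 by rewrite /t !dotE !crossE; ring.
(* Lagrange's identity for the products with [m = cross e t]; the double cross products evaluate the
   same quantity through [e] and [t]. *)
have : dot (cross v (cross e t)) (cross w (cross e t)) =
       dot v w - dot v m * dot w m.
  by rewrite frame_cross dot_cross_cross mm mulr1 (dotC m w).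
rewrite !cross_cross !(dotBl, dotBr, dotZl, dotZr) ee tt (dotC t e) et => h.
lra.
Qed.

Lemma frame_triple v w :
  dot (cross m v) w = dot v e * dot w t - dot v t * dot w e.
Proof. by rewrite cross_dotA -frame_cross dot_cross_cross. Qed.

End Frame.
End VectorAlgebra.

(** * The mirror relation at one edge and around the quadrilateral *)

Lemma I4_succ : (((0 + 1)%R = 1 :> 'I_4) * ((1 + 1)%R = 2%:R :> 'I_4) *
  ((2%:R + 1)%R = 3%:R :> 'I_4) * ((3%:R + 1)%R = 0 :> 'I_4))%type.
Proof. by do ![split]; apply: val_inj. Qed.

Lemma I4_ind (P : 'I_4 -> Prop) : P 0 -> P 1 -> P 2%:R -> P 3%:R ->
  forall j, P j.
Proof.
move=> P0 P1 P2 P3 [[|[|[|[|//]]]] hj].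
- by rewrite (_ : Ordinal hj = 0) //; apply: val_inj.
- by rewrite (_ : Ordinal hj = 1) //; apply: val_inj.
- by rewrite (_ : Ordinal hj = 2%:R) //; apply: val_inj.
- by rewrite (_ : Ordinal hj = 3%:R) //; apply: val_inj.
Qed.

(** In the first identity each side is [dot D w] minus the product of the normal components, which
    agree at both ends. For the second, [m + m'], [D] and [w] are all orthogonal to [m - m'], so
    their triple product vanishes. *)
Lemma edge_mirror (R : realType) (e m e' m' D w : 'rV[R]_3) :
  dot e e = 1 -> dot m m = 1 -> dot m e = 0 ->
  dot e' e' = 1 -> dot m' m' = 1 -> dot m' e' = 0 ->
  m != m' -> dot D m = dot D m' -> dot w m = dot w m' ->
  let t := cross m e in let t' := cross m' e' in
  dot D e * dot w e + dot D t * dot w t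
    = dot D e' * dot w e' + dot D t' * dot w t' /\
  dot D e * dot w t - dot D t * dot w e
    = - (dot D e' * dot w t' - dot D t' * dot w e').
Proof.
move=> ee mm me ee' mm' me' mNm' Dm wm t t'; split.
  have := frame_dot ee mm me D w; rewrite (frame_dot ee' mm' me' D w) Dm wm.
  rewrite -/t -/t'; lra.
rewrite -frame_triple // -frame_triple //.
apply/eqP; rewrite -addr_eq0; apply/eqP.
transitivity (dot (cross (m + m') D) w).
  by rewrite ?(dotE, crossE, mxE); ring.
apply: (@triple_ortho _ (m - m')); first by rewrite subr_eq0.
- by rewrite dotDl !dotBr mm mm' (dotC m' m); ring.
- by rewrite dotBr Dm subrr.
- by rewrite dotBr wm subrr.
Qed.

(* With [z_j = x_j + i y_j] and [zeta_j = d + i rho_j], the hypotheses say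
   [z_j * zeta_j^* = z_(j+1)^* * zeta_j]; eliminating [z_1], [z_2], [z_3]
   shows that [zeta_0 * zeta_1^* * zeta_2 * zeta_3^*] is real. *)
Lemma mirror_cycle (R : realType) (d : R) (rho x y : 'I_4 -> R) :
  (forall j, d * x j + rho j * y j = d * x (j + 1) + rho j * y (j + 1)) ->
  (forall j, d * y j - rho j * x j
             = - (d * y (j + 1) - rho j * x (j + 1))) ->
  d != 0 -> (x 0 != 0) || (y 0 != 0) ->
  d ^+ 2 * (rho 1 + rho 3%:R - rho 0 - rho 2%:R)
  + (rho 1 * rho 3%:R * (rho 0 + rho 2%:R)
     - rho 0 * rho 2%:R * (rho 1 + rho 3%:R)) = 0.
Proof.
move=> re im d0 z0.
have := (im 3%:R, im 2%:R, im 1, im 0); have := (re 3%:R, re 2%:R, re 1, re 0).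
rewrite !I4_succ.
move: (x 0) (x 1) (x 2%:R) (x 3%:R) (y 0) (y 1) (y 2%:R) (y 3%:R) z0
  (rho 0) (rho 1) (rho 2%:R) (rho 3%:R).
move=> x0 x1 x2 x3 y0 y1 y2 y3 z0 a b c f [[[U3 U2] U1] U0] [[[V3 V2] V1] V0].
pose u p z w z' w' := d * z + p * w - (d * z' + p * w').
pose v p z w z' w' := d * w - p * z + (d * w' - p * z').
have [u0 u1 u2 u3] : [/\ u a x0 y0 x1 y1 = 0, u b x1 y1 x2 y2 = 0,
  u c x2 y2 x3 y3 = 0 & u f x3 y3 x0 y0 = 0].
  by split; rewrite /u ?U0 ?U1 ?U2 ?U3 subrr.
have [v0 v1 v2 v3] : [/\ v a x0 y0 x1 y1 = 0, v b x1 y1 x2 y2 = 0,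
  v c x2 y2 x3 y3 = 0 & v f x3 y3 x0 y0 = 0].
  by split; rewrite /v ?V0 ?V1 ?V2 ?V3 addNr.
(* Real and imaginary parts of [(d + i p) (d + i q) (d + i r)]; a negated argument stands for a
   conjugate factor. *)
pose re3 p q r := d * (d ^+ 2 - p * q - q * r - p * r).
pose im3 p q r := d ^+ 2 * (p + q + r) - p * q * r.
set B := (X in X = 0).
(* [u + i v] is the defect of each relation. The defects, every second one conjugated, times the
   other three factors telescope to [2 i d B z_0], where [- d B] is the imaginary part of
   [zeta_0 * zeta_1^* * zeta_2 * zeta_3^*]. *)
have By : - (2 * d * B * y0) =
    u a x0 y0 x1 y1 * re3 b (- c) f - v a x0 y0 x1 y1 * im3 b (- c) f
  + (u b x1 y1 x2 y2 * re3 a (- c) f + v b x1 y1 x2 y2 * im3 a (- c) f)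
  + (u c x2 y2 x3 y3 * re3 a (- b) f - v c x2 y2 x3 y3 * im3 a (- b) f)
  + (u f x3 y3 x0 y0 * re3 a (- b) c + v f x3 y3 x0 y0 * im3 a (- b) c).
  rewrite /B /u /v /re3 /im3; ring.
have Bx : 2 * d * B * x0 =
    u a x0 y0 x1 y1 * im3 b (- c) f + v a x0 y0 x1 y1 * re3 b (- c) f
  + (u b x1 y1 x2 y2 * im3 a (- c) f - v b x1 y1 x2 y2 * re3 a (- c) f)
  + (u c x2 y2 x3 y3 * im3 a (- b) f + v c x2 y2 x3 y3 * re3 a (- b) f)
  + (u f x3 y3 x0 y0 * im3 a (- b) c - v f x3 y3 x0 y0 * re3 a (- b) c).
  rewrite /B /u /v /re3 /im3; ring.
move: Bx By; rewrite u0 u1 u2 u3 v0 v1 v2 v3 !mul0r !(addr0, subr0).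
move=> Bx /eqP; rewrite oppr_eq0 => /eqP By.
apply/eqP; case/orP: z0 => z0.
  by move/eqP: Bx; rewrite !mulf_eq0 (negPf z0) (negPf d0) pnatr_eq0 orbF.
by move/eqP: By; rewrite !mulf_eq0 (negPf z0) (negPf d0) pnatr_eq0 orbF.
Qed.

Lemma sum_I4 (V : zmodType) (F : 'I_4 -> V) :
  \sum_(j < 4) F j = F 0 + F 1 + F 2%:R + F 3%:R.
Proof.
rewrite !big_ord_recl big_ord0 addr0 !addrA.
by congr (F _ + F _ + F _ + F _); apply: val_inj.
Qed.

(** * A single quadrilateral: coplanar normals and oriented areas *)

Section Quadrilateral.
Variables (R : realType) (p n : 'I_4 -> 'rV[R]_3) (r : 'I_4 -> R).
Hypothesis sphere : forall j, p j + r j *: n j = p (j + 1) + r j *: n (j + 1).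
Hypothesis r23 : r 2%:R != r 3%:R.

Lemma edge_parallel j : p (j + 1) - p j = - r j *: (n (j + 1) - n j).
Proof.
rewrite scaleNr scalerBr opprB; apply/eqP; rewrite subr_eq addrAC eq_sym.
by rewrite subr_eq addrC -sphere addrC.
Qed.

(** The edges of [p] sum to zero, and so do those of [n]; adding a multiple [r 3%:R] of the latter
    sum eliminates the closing edge. *)
Lemma edge_relation :
  (r 0 - r 3%:R) *: (n 1 - n 0) + (r 1 - r 3%:R) *: (n 2%:R - n 1)
  + (r 2%:R - r 3%:R) *: (n 3%:R - n 2%:R) = 0.
Proof.
have := (edge_parallel 0, edge_parallel 1, edge_parallel 2%:R,
         edge_parallel 3%:R).
rewrite !I4_succ => -[[[h0 h1] h2] h3].
apply/rowP => l; move/rowP/(_ l): h0; move/rowP/(_ l): h1.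
move/rowP/(_ l): h2; move/rowP/(_ l): h3; rewrite !mxE; lra.
Qed.

Lemma normals_coplanar :
  exists2 w, w != 0 & forall j, dot w (n j) = dot w (n (j + 1)).
Proof.
have [w w0 [h0 h1]] := exists_ortho (n 1 - n 0) (n 2%:R - n 1).
have h2 : dot (n 3%:R - n 2%:R) w = 0.
  have := congr1 (fun v => dot v w) edge_relation.
  rewrite [LHS]dotDl [X in X + _ = _ -> _]dotDl !dotZl h0 h1 dot0l !mulr0 !add0r.
  by move/eqP; rewrite mulf_eq0 subr_eq0 (negPf r23) => /eqP.
exists w => //; move: h0 h1 h2; rewrite !dotBl !(dotC _ w) => h0 h1 h2.
by apply: I4_ind; rewrite !I4_succ; lra.
Qed.

(* Four vectors in a plane with [sum a_j = 0] and [sum r_j a_j = 0] have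
   [2 x 2] minors proportional to the complementary minors of
   [(1, 1, 1, 1), (r_0, r_1, r_2, r_3)]; [l] is the factor. *)
Lemma oriented_areas w : exists l,
  oriented_area w n = l * (r 1 + r 3%:R - r 0 - r 2%:R) /\
  oriented_area w p = l * (r 1 * r 3%:R * (r 0 + r 2%:R)
                           - r 0 * r 2%:R * (r 1 + r 3%:R)).
Proof.
have areaE (x : 'I_4 -> 'rV[R]_3) : oriented_area w x = 2^-1 *
    (dot (cross (x 1 - x 0) (x 2%:R - x 1)) w
     + dot (cross (x 1 - x 0) (x 3%:R - x 2%:R)) w
     + dot (cross (x 2%:R - x 1) (x 3%:R - x 2%:R)) w).
  rewrite /oriented_area sum_I4.
  rewrite !I4_succ ?(dotE, crossE, mxE); ring.
rewrite !areaE.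
have := (edge_parallel 0, edge_parallel 1, edge_parallel 2%:R).
rewrite !I4_succ => -[[-> ->] ->]; have := edge_relation.
move: (n 1 - n 0) (n 2%:R - n 1) (n 3%:R - n 2%:R) => a b c rel.
move: r23; rewrite -subr_eq0 => r230.
(* Crossing the edge relation with [a], and below with [b], reduces every minor to that of [a] and
   [b]. *)
have h1 : dot (cross a c) w =
    - (r 1 - r 3%:R) / (r 2%:R - r 3%:R) * dot (cross a b) w.
  have /(congr1 (fun v => dot (cross a v) w)) := rel.
  have -> : dot (cross a 0) w = 0 by rewrite ?(dotE, crossE, mxE); ring.
  have -> : dot (cross a ((r 0 - r 3%:R) *: a + (r 1 - r 3%:R) *: b
      + (r 2%:R - r 3%:R) *: c)) w = (r 1 - r 3%:R) * dot (cross a b) w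
      + (r 2%:R - r 3%:R) * dot (cross a c) w.
    by rewrite ?(dotE, crossE, mxE); ring.
  move=> h; apply: (mulfI r230).
  move/eqP: h; rewrite addrC addr_eq0 => /eqP ->; field; exact: r230.
have h2 : dot (cross b c) w =
    (r 0 - r 3%:R) / (r 2%:R - r 3%:R) * dot (cross a b) w.
  have /(congr1 (fun v => dot (cross b v) w)) := rel.
  have -> : dot (cross b 0) w = 0 by rewrite ?(dotE, crossE, mxE); ring.
  have -> : dot (cross b ((r 0 - r 3%:R) *: a + (r 1 - r 3%:R) *: b
      + (r 2%:R - r 3%:R) *: c)) w = - (r 0 - r 3%:R) * dot (cross a b) w
      + (r 2%:R - r 3%:R) * dot (cross b c) w.
    by rewrite ?(dotE, crossE, mxE); ring.
  move=> h; apply: (mulfI r230).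
  move/eqP: h; rewrite addrC addr_eq0 => /eqP ->; field; exact: r230.
exists (- 2^-1 * dot (cross a b) w / (r 2%:R - r 3%:R)).
have sc x y u v : dot (cross (x *: u) (y *: v)) w = x * y * dot (cross u v) w.
  by rewrite ?(dotE, crossE, mxE); ring.
rewrite !sc h1 h2; split; field; rewrite ?pnatr_eq0 //; exact: r230.
Qed.

End Quadrilateral.

(** * Relative rotation axes, and what skewness excludes *)

Lemma skew_disjoint (R : realType) (L L' : set 'rV[R]_3) (x : 'rV[R]_3) :
  Defs.skew L L' -> L x -> L' x -> False.
Proof.
case=> -[a [u [u0 ->]]] [a' [u' [u0' ->]]] nplane [t xt] [t' xt'].
have [w w0 [uw uw']] := exists_ortho u u'.
apply: nplane; exists (plane_through x w); split; first by exists x, w.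
- move=> y [s ->]; rewrite /plane_through /= xt.
  by rewrite !(dotBl, dotDl, dotZl) uw !mulr0 subrr.
- move=> y [s ->]; rewrite /plane_through /= xt'.
  by rewrite !(dotBl, dotDl, dotZl) uw' !mulr0 subrr.
Qed.

Lemma line_direction (R : realType) (L : set 'rV[R]_3) (x y v : 'rV[R]_3) :
  is_line L -> L x -> L y -> L (y + v) -> v != 0 ->
  exists t, y - x = t *: v.
Proof.
case=> a [u [u0 ->]] [tx ->] [ty ->] [tv hv] v0.
have vE : v = (tv - ty) *: u.
  by rewrite scalerBl -(addKr (a + ty *: u) v) hv opprD addrACA addNr add0r addrC.
have t0 : tv - ty != 0.
  by apply: contraNneq v0 => h; rewrite vE h scale0r.
exists ((ty - tx) / (tv - ty)).
by rewrite vE scalerA divfK // scalerBl opprD addrACA subrr add0r.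
Qed.

Lemma move_carries (R : realType) (A : displacement R) (M c : contact_element R)
    t :
  carries A M c -> move A (pt M + t *: nrm M) = pt c + t *: nrm c.
Proof.
by case=> <- <-; rewrite /move mulmxDl -scalemxAl addrAC.
Qed.

(** Equal consecutive radii would give the same sphere centre in the moving space, a common point of
    two skew axes. *)
Lemma radii_neq (R : realType) (A : 'I_4 -> displacement R)
    (M : contact_element R) (c : 'I_4 -> contact_element R) (r : 'I_4 -> R) j :
  let K j := relative_axis (A j) (A (j + 1)) in
  (forall j, carries (A j) M (c j)) -> Defs.skew (K j) (K (j + 1)) ->
  (forall j, pt (c j) + r j *: nrm (c j)
             = pt (c (j + 1)) + r j *: nrm (c (j + 1))) ->
  r j != r (j + 1).
Proof.
move=> K AM Ksk sph; apply/eqP => rj.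
have inK i : K i (pt M + r i *: nrm M).
  by rewrite /K /relative_axis /= !(move_carries _ (AM _)) sph.
by apply: (skew_disjoint Ksk (inK j)); rewrite rj.
Qed.

(** If the normals agreed, so would the points, and the axis would be the normal line of [M']. It
    also contains the sphere centre of [M], so [pt c' - pt c] would be a combination of the two
    normals, yet orthogonal to both. *)
Lemma nrm_neq (R : realType) (A B : displacement R)
    (M M' c c' k k' : contact_element R) (r s : R) :
  carries A M c -> carries A M' c' -> carries B M k -> carries B M' k' ->
  is_line (relative_axis A B) ->
  pt c + r *: nrm c = pt k + r *: nrm k ->
  pt c' + s *: nrm c' = pt k' + s *: nrm k' ->
  dot (nrm c) (pt c' - pt c) = 0 -> dot (nrm c') (pt c' - pt c) = 0 ->
  pt c <> pt c' -> nrm c' != nrm k'.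
Proof.
move=> AM AM' BM BM' Kline sph sph' ne me pq; apply/eqP => mk.
have qk : pt c' = pt k' by move: sph'; rewrite mk; apply: addIr.
pose K := relative_axis A B.
have Kx : K (pt M + r *: nrm M).
  by rewrite /K /relative_axis /= (move_carries _ AM) (move_carries _ BM).
have Ky t : K (pt M' + t *: nrm M').
  by rewrite /K /relative_axis /= (move_carries _ AM') (move_carries _ BM') qk mk.
have M0 : nrm M' != 0 by rewrite -dot_eq0 nrm_dot oner_eq0.
have := Ky 0; rewrite scale0r addr0 => Ky0.
have := Ky 1; rewrite scale1r => Ky1.
have [t ht] := line_direction Kline Kx Ky0 Ky1 M0.
have : move A (pt M') - move A (pt M + r *: nrm M) = t *: nrm c'.
  rewrite -AM'.2 scalemxAl -ht mulmxBl /move opprD addrACA subrr addr0 //.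
rewrite (move_carries _ AM) AM'.1 => h.
have /(congr1 (fun v => dot v (pt c' - pt c))) := h.
rewrite opprD addrA dotBl !dotZl ne me !mulr0 subr0 => /eqP.
by rewrite dot_eq0 subr_eq0 => /eqP; apply: nesym.
Qed.

(** * One pair of corresponding contact elements *)

Section ContactPair.
Variables (R : realType) (c c' : contact_element R) (d phi : R).
Let p := pt c. Let q := pt c'. Let n := nrm c. Let m := nrm c'.
Let e := d^-1 *: (q - p).
Let t := cross m e.
Hypotheses (dist : enorm (q - p) = d) (ang : is_ccw_angle e n m phi)
  (pq : p <> q)
  (planes : (tangent_plane c `&` tangent_plane c')%classic
            = line_through p (q - p)).

Lemma dist_neq0 : d != 0.
Proof.
rewrite -dist -sqrf_eq0 enorm_sqr dot_eq0 subr_eq0.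
by apply/eqP; apply: nesym.
Qed.

Lemma connecting_ortho : dot n (q - p) = 0 /\ dot m (q - p) = 0.
Proof.
have [_ pm] : (tangent_plane c `&` tangent_plane c')%classic p.
  by rewrite planes; exists 0; rewrite scale0r addr0.
have [qn _] : (tangent_plane c `&` tangent_plane c')%classic q.
  by rewrite planes; exists 1; rewrite scale1r addrC subrK.
split; first by rewrite dotC.
by rewrite dotC -(opprB p q) -scaleN1r dotZl pm mulr0.
Qed.

Lemma pair_frame : [/\ dot e e = 1, dot m e = 0, dot n e = 0,
  dot n m = cos phi & dot n t = - sin phi].
Proof.
have [ne me] := connecting_ortho; have [nm <-] := ang.
rewrite /e !(dotZl, dotZr) ne me !mulr0; split => //.
  by rewrite -enorm_sqr dist; field; exact: dist_neq0.
by rewrite /t ?(dotE, crossE, mxE); ring.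
Qed.

(** Otherwise [n] is orthogonal to [t], so [p + t] lies in both tangent planes but off the
    connecting line. *)
Lemma sin_neq0 : sin phi != 0.
Proof.
apply/eqP => s0; have [ee me ne nm] := pair_frame; rewrite s0 oppr0 => nt.
have [tau /addrI ht] : line_through p (q - p) (p + t).
  rewrite -planes; split; rewrite /tangent_plane /plane_through /=.
    by rewrite -/p addrC addKr dotC.
  have [_ mqp] := connecting_ortho.
  rewrite -/q -/m addrAC dotDl -(opprB q p) -scaleN1r dotZl (dotC _ m) mqp.
  by rewrite mulr0 add0r /t ?(dotE, crossE, mxE); ring.
have tt : dot t t = 1.
  by rewrite dot_cross_cross ee nrm_dot me mul0r subr0 mulr1.
have et : dot t e = 0 by rewrite /t !dotE !crossE; ring.
have qpE : q - p = d *: e by rewrite scalerA divff ?dist_neq0 ?scale1r.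
move: tt; rewrite {1}ht dotZl qpE (dotZl d e) (dotC e) et !mulr0 => /eqP.
by rewrite eq_sym oner_eq0.
Qed.

End ContactPair.

(** * Curvature of one elementary quadrilateral *)

Lemma quad_curvature (R : realType) (c c' : 'I_4 -> contact_element R)
    (d phi K : R) :
  (forall j, common_tangent_sphere (c j) (c (j + 1))) ->
  (forall j, common_tangent_sphere (c' j) (c' (j + 1))) ->
  (forall j, let p := pt (c j) in let q := pt (c' j) in
     [/\ enorm (q - p) = d,
         is_ccw_angle (d^-1 *: (q - p)) (nrm (c j)) (nrm (c' j)) phi,
         p <> q &
         (tangent_plane (c j) `&` tangent_plane (c' j))%classic
           = line_through p (q - p)]) ->
  generic_pair c c' -> gaussian_curvature c K ->
  gaussian_curvature c (- (sin phi ^+ 2 / d ^+ 2)).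
Proof.
move=> /choice[r sph] /choice[s sph'] pairs
  [M [M' [A [AM Kline Ksk _]]]] [w [w1 pw nw S0 _]].
have AMc j := (AM j).1; have AMc' j := (AM j).2.
have rN j : r j != r (j + 1) := radii_neq AMc (Ksk j) sph.
have sN j : s j != s (j + 1) := radii_neq AMc' (Ksk j) sph'.
have mN j : nrm (c' j) != nrm (c' (j + 1)).
  have [dist ang pq planes] := pairs j.
  have [ne me] := connecting_ortho planes.
  exact: (nrm_neq (AMc j) (AMc' j) (AMc (j + 1)) (AMc' (j + 1)) (Kline j)
    (sph j) (sph' j) ne me pq).
have d0 : d != 0 by have [dist _ pq _] := pairs 0; exact: dist_neq0 dist pq.
have sin0 : sin phi != 0.
  by have [dist ang pq planes] := pairs 0; exact: sin_neq0 dist ang pq planes.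
pose e j := d^-1 *: (pt (c' j) - pt (c j)).
pose m j := nrm (c' j); pose n j := nrm (c j); pose t j := cross (m j) (e j).
have frame j : [/\ dot (e j) (e j) = 1, dot (m j) (e j) = 0,
    dot (n j) (e j) = 0, dot (n j) (m j) = cos phi &
    dot (n j) (t j) = - sin phi].
  by have [dist ang pq planes] := pairs j; exact: pair_frame dist ang pq planes.
have mm j : dot (m j) (m j) = 1 by exact: nrm_dot.
have s23 : s 2%:R != s 3%:R by have := sN 2%:R; rewrite !I4_succ.
have r23 : r 2%:R != r 3%:R by have := rN 2%:R; rewrite !I4_succ.
have [v v0 vm] : exists2 v, v != 0 & forall j, dot v (m j) = dot v (m (j + 1)).
  exact: normals_coplanar sph' s23.
(* [D j] joins the two sphere centres at edge [j]; as the spheres are shared, it can be expanded at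
   either end of the edge. *)
pose D j := pt (c' j) + s j *: m j - (pt (c j) + r j *: n j).
have DE j : D j = d *: e j + s j *: m j - r j *: n j.
  by rewrite /D /e scalerA divff // scale1r opprD addrACA addrA.
have DS j : D j = d *: e (j + 1) + s j *: m (j + 1) - r j *: n (j + 1).
  by rewrite /D sph sph' /e scalerA divff // scale1r opprD addrACA addrA.
(* The component along [m j] depends only on the radii, so it agrees at both ends; the tangential
   part is [d + i r_j sin phi]. *)
have dots a b j : let E := d *: e j + a *: m j - b *: n j in
    [/\ dot E (e j) = d, dot E (m j) = a - b * cos phi &
        dot E (t j) = b * sin phi].
  rewrite /=; move: (frame j) (mm j); rewrite /t.
  move: (e j) (m j) (n j) => e1 m1 n1 [ee me ne nm nt] mm1.
  have et : dot e1 (cross m1 e1) = 0 by rewrite !dotE !crossE; ring.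
  have mt : dot m1 (cross m1 e1) = 0 by rewrite !dotE !crossE; ring.
  rewrite !(dotBl, dotDl, dotZl) ee (dotC e1 m1) me ne nm nt mm1 et mt.
  by split; ring.
pose x j := dot v (e j); pose y j := dot v (t j).
have mirror j :
    d * x j + r j * sin phi * y j
      = d * x (j + 1) + r j * sin phi * y (j + 1) /\
    d * y j - r j * sin phi * x j
      = - (d * y (j + 1) - r j * sin phi * x (j + 1)).
  have [ee me _ _ _] := frame j; have [ee' me' _ _ _] := frame (j + 1).
  have := dots (s j) (r j) j; rewrite -DE => -[De Dm Dt].
  have := dots (s j) (r j) (j + 1); rewrite -DS => -[De' Dm' Dt'].
  have := edge_mirror ee (mm j) me ee' (mm (j + 1)) me' (mN j)
    (etrans Dm (esym Dm')) (vm j).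
  by rewrite /= -/(t j) -/(t (j + 1)) De De' Dt Dt'.
(* Without tangential part at [m 0], [v] would be a multiple of [m 0], and [vm] would force
   [m 1 = m 0]. *)
have xy0 : (x 0 != 0) || (y 0 != 0).
  rewrite -negb_and; apply/negP => /andP[/eqP x0 /eqP y0].
  have [ee me _ _ _] := frame 0.
  have vdot u : dot v u = dot v (m 0) * dot u (m 0).
    by rewrite (frame_dot ee (mm 0) me) -/(x 0) -/(y 0) x0 y0; ring.
  have vm0 : dot v (m 0) != 0.
    by apply: contraNneq v0 => h; rewrite -dot_eq0 vdot h mul0r.
  have m10 : dot (m (0 + 1)) (m 0) = 1.
    by apply: (mulfI vm0); rewrite -vdot -vm mulr1.
  have := mN 0; rewrite -subr_eq0 -dot_eq0 -/(m 0) -/(m (0 + 1)).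
  by rewrite !(dotBl, dotBr) !mm (dotC (m 0)) m10 !subrr eqxx.
have := mirror_cycle (fun j => (mirror j).1) (fun j => (mirror j).2) d0 xy0.
have [l [SnE SpE]] := oriented_areas sph r23 w.
move=> rel; exists w; split=> //; apply: (mulIf S0); rewrite divfK //.
(* [rel] times [l] reads [sin phi (d^2 S_0 + sin^2 phi S) = 0]. *)
have d20 : d ^+ 2 != 0 by rewrite expf_neq0.
apply: (mulfI d20); rewrite mulrA mulrN [d ^+ 2 * (_ / _)]mulrC divfK //.
apply: (mulfI sin0); apply/eqP; rewrite -subr_eq0; apply/eqP.
transitivity (- l * 0 : R); last by rewrite mulr0.
by rewrite -rel SnE SpE; ring.
Qed.

Theorem theorem4 (R : realType) (k : nat) (hk : (2 <= k)%N)
    (f g : net R k) (d phi : R)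
    (hfg : backlund_mates f g d phi)
    (hK : forall (i : 'rV[int]_k) (a b : 'I_k), a != b ->
      exists K : R, gaussian_curvature (quad f i a b) K)
    (hgen : forall (i : 'rV[int]_k) (a b : 'I_k), a != b ->
      generic_pair (quad f i a b) (quad g i a b)) :
  forall (i : 'rV[int]_k) (a b : 'I_k), a != b ->
    gaussian_curvature (quad f i a b) (- (sin phi ^+ 2 / d ^+ 2)).
Proof.
move=> i a b ab; case: hfg => pf pg pairs; have [K hKi] := hK i a b ab.
have sphC (c c' : contact_element R) :
    common_tangent_sphere c c' -> common_tangent_sphere c' c.
  by case=> r h; exists r.
have quad_sph (h : net R k) : principal h -> forall j,
    common_tangent_sphere (quad h i a b j) (quad h i a b (j + 1)).
  move=> ph; apply: I4_ind; rewrite I4_succ.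
  - exact: ph.
  - exact: ph.
  (* The last two edges run against the lattice steps. *)
  - by rewrite /quad !(tnth_nth (h i)) /= addrAC; apply: sphC; apply: ph.
  - by apply: sphC; apply: ph.
apply: (quad_curvature (quad_sph f pf) (quad_sph g pg) _ (hgen i a b ab) hKi).
by apply: I4_ind; apply: pairs.
Qed.
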